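(* Let $\Omega$ be any infinite set and let $\mathcal{P}=\{\Sigma_0,\Sigma_1,\ldots,\Sigma_{n-1}\}$, $n\geq 2$, be a finite partition of $\Omega$. Then $\operatorname{AStab}(\mathcal{P})$ is a maximal subsemigroup of $\operatorname{Sym}(\Omega)$.
   Context: $\operatorname{Sym}(\Omega)$ is the symmetric group on $\Omega$; $\Sigma f$ denotes the image of $\Sigma$ under $f$. A finite partition of $\Omega$ is a partition $\{\Sigma_0,\ldots,\Sigma_{n-1}\}$ of $\Omega$ into $n\geq 2$ parts with $|\Sigma_0|=\cdots=|\Sigma_{n-1}|=|\Omega|$. Its almost stabiliser is $\operatorname{AStab}(\mathcal{P})=\{f\in\operatorname{Sym}(\Omega):(\forall i)(\exists j)(|\Sigma_i f\setminus\Sigma_j|+|\Sigma_j\setminus\Sigma_i f|<|\Omega|)\}$. A subsemigroup $T$ of a semigroup (or group) $S$ is a maximal subsemigroup if $T\neq S$ and the subsemigroup generated by $T$ and $s$ equals $S$ for all $s\in S\setminus T$ (generation is as a semigroup, without taking inverses). *)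

(* Defs.v *)
From HB Require Import structures.
From mathcomp Require Import all_boot all_classical.

Set Implicit Arguments.
Unset Strict Implicit.
Unset Printing Implicit Defensive.

Local Open Scope classical_set_scope.
Local Open Scope card_scope.

Definition card_lt T U (A : set T) (B : set U) : bool :=
  (A #<= B) && (A #!= B).
Notation "A '#<' B" := (card_lt A B)
  (at level 79, format "A  '#<'  B") : card_scope.

(* A set whose cardinality is the cardinal sum |A| + |B|: the disjoint union
   of A and B. *)
Definition card_sum T U (A : set T) (B : set U) :
    set (set_type A + set_type B)%type :=
  setT.
Arguments card_sum {T U} A B.
Notation "A '#+' B" := (card_sum A B)
  (at level 50, left associativity, format "A  '#+'  B") : card_scope.

Record sym (T : Type) := Sym { sym_fun :> T -> T; sym_bij : bijective sym_fun }.

Section SymGroup.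
Variable T : Type.
Implicit Types f g h : sym T.

Lemma symP f g : (forall x, f x = g x) -> f = g.
Proof.
case: f g => [f fb] [g gb] /= /funext fg; subst g.
by rewrite (Prop_irrelevance fb gb).
Qed.

Definition sym_one : sym T := Sym (Bijective (frefl id) (frefl id)).

(* Permutations act on the right: f * g is f followed by g. *)
Definition sym_mul f g : sym T := Sym (bij_comp (sym_bij g) (sym_bij f)).

Lemma sym_inv_ex f : exists g : sym T, cancel f g /\ cancel g f.
Proof.
by case: f => f /= [g fK gK]; exists (Sym (Bijective gK fK)).
Qed.

Definition sym_inv f : sym T := projT1 (cid (sym_inv_ex f)).

Lemma sym_funK f : cancel f (sym_inv f).
Proof. by rewrite /sym_inv; case: cid => g []. Qed.

Lemma sym_invK f : cancel (sym_inv f) f.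
Proof. by rewrite /sym_inv; case: cid => g []. Qed.

Lemma sym_mulA : associative sym_mul.
Proof. by move=> f g h; apply: symP. Qed.

Lemma sym_mul1g : left_id sym_one sym_mul.
Proof. by move=> f; apply: symP. Qed.

Lemma sym_mulg1 : right_id sym_one sym_mul.
Proof. by move=> f; apply: symP. Qed.

Lemma sym_mulVg : left_inverse sym_one sym_inv sym_mul.
Proof. by move=> f; apply: symP => x; exact: sym_invK. Qed.

Lemma sym_mulgV : right_inverse sym_one sym_inv sym_mul.
Proof. by move=> f; apply: symP => x; exact: sym_funK. Qed.

HB.instance Definition _ := gen_eqMixin (sym T).
HB.instance Definition _ := gen_choiceMixin (sym T).
HB.instance Definition _ := isGroup.Build (sym T)
  sym_mulA sym_mul1g sym_mulg1 sym_mulVg sym_mulgV.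

End SymGroup.

Section Semigroups.
Variable S : semigroupType.

Definition subsemigroup (A : set S) : Prop :=
  A !=set0 /\ forall x y, A x -> A y -> A (x * y)%g.

Definition generated_subsemigroup (X : set S) : set S :=
  smallest subsemigroup X.

Definition maximal_subsemigroup (A : set S) : Prop :=
  [/\ subsemigroup A, A <> setT &
      forall s, ~ A s -> generated_subsemigroup (A `|` [set s]) = setT].

End Semigroups.

Section AlmostStabiliser.
Variables (T : Type) (n : nat).

(* The family is automatically injective, since its members are disjoint and
   nonempty. *)
Definition finite_partition (Sigma : 'I_n -> set T) : Prop :=
  [/\ (2 <= n)%N, partition setT Sigma setT &
      forall i, Sigma i #= [set: T]].

Definition AStab (Sigma : 'I_n -> set T) : set (sym T) :=
  [set f : sym T | forall i, exists j,
     ((f @` Sigma i `\` Sigma j) #+ (Sigma j `\` f @` Sigma i)) #< [set: T]].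

End AlmostStabiliser.

(* Main.v *)
Require Import Defs.
From mathcomp Require Import all_boot fingroup perm all_classical.

Set Implicit Arguments.
Unset Strict Implicit.
Unset Printing Implicit Defensive.

(** Call a subset of the infinite type [T] large when it has the cardinality
    of [T]. Describe the partition by the map [p] sending a point to the index
    of its part, and a permutation [f] by its link relation on indices:
    [link f i j] holds when the points that [f] carries from part [i] to part
    [j] form a large set. The parts are large and a finite union of sets that
    are not large is not large, so the link relation is total and surjective,
    and [f] lies in the almost stabiliser exactly when it is single-valued
    ([AStabE]). Every link of a product is a composition of links of the
    factors, so the almost stabiliser is a subsemigroup; a permutation whose links are all present is not in it.

    For maximality, let [U] be a subsemigroup containing the almost stabiliser
    and some [f] in which a part [i] has two links. Between two elements of
    [U] one may insert a permutation that moves the parts among themselves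
    along any prescribed permutation of the indices and is otherwise generic;
    the result then has every link that composing relations would give
    ([link_compose], which rests on [generic_bij]). Such products produce an
    element of [U] with all links. First maximise the number of links of [i]:
    if an index [c] is missed, some part [i'] is linked to [c], and sending one
    of two indices linked to [i] onto [i], the other one onto [i'], keeps the
    links of [i] and adds [c]. Then maximise the number of parts having all
    links: if [i'] is not one of them, sending an index linked to [i'] onto
    [i] adds it.

    Finally any two permutations with all links differ by factors on the left
    and on the right that preserve every part
    ([all_linked_double_coset]), so [U] contains all of them, and every
    permutation is a product of two of them ([all_linked_factor]). *)

Local Open Scope classical_set_scope.
Local Open Scope card_scope.

(** * Cardinal comparison *)

(** Comparing cardinals through a relation avoids providing a default value in
    [U], which may be empty. *)
Lemma card_le_rel T U (A : set T) (B : set U) (G : T -> U -> Prop) :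
    (forall x, A x -> exists2 y, B y & G x y) ->
    (forall x x' y, G x y -> G x' y -> x = x') ->
  A #<= B.
Proof.
move=> Gtot Ginj.
have /choice[f fP] (x : set_type A) : exists y, B y /\ G (val x) y.
  by have [y] := Gtot _ (set_mem (valP x)); exists y.
rewrite -(card_le_eql (card_setT A)).
have [g] : $|{injfun [set: set_type A] >-> B}|.
  apply/injfunPex; exists f => [x _|x y _ _ fxy]; first by case: (fP x).
  by apply/val_inj/(Ginj _ _ (f x)); [case: (fP x)|rewrite fxy; case: (fP y)].
exact: inj_card_le.
Qed.

Lemma card_le_fun T U (A : set T) (B : set U) (f : T -> U) :
  (forall x, A x -> B (f x)) -> set_inj A f -> A #<= B.
Proof.
move=> fAB finj; apply: (@card_le_rel _ _ _ _ (fun x y => A x /\ f x = y)).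
  by move=> x Ax; exists (f x); [exact: fAB|].
by move=> x x' y [Ax fx] [Ax' fx']; apply: finj; rewrite ?inE// fx fx'.
Qed.

Lemma card_leT_fun T U (B : set U) : [set: T] #<= B ->
  exists2 f : T -> U, injective f & forall x, B (f x).
Proof.
move=> /card_leP[h].
exists (fun x => val (h (SigSub (mem_set (Logic.I : [set: T] x))))) => [x y|x].
  by move=> /val_inj/(inj (mem_set Logic.I) (mem_set Logic.I))[].
by apply: set_mem; exact: valP.
Qed.

(** Zorn's lemma gives a maximal partial matching between [A] and [B], and
    maximality forces it to exhaust one of the two sets. *)
Lemma card_le_total T U (A : set T) (B : set U) : A #<= B \/ B #<= A.
Proof.
pose P (G : set (T * U)) :=
  (forall u, G u -> A u.1 /\ B u.2) /\
  (forall u v, G u -> G v -> (u.1 = v.1 <-> u.2 = v.2)).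
have [F FP Ftot|G [[GAB Ginj] Gmax]] := @Zorn_bigcup _ P.
  split=> [u [X FX Xu]|u v [X FX Xu] [Y FY Yv]].
    by have [+ _] := FP _ FX; apply.
  have [XY|YX] := Ftot _ _ FX FY.
    by have [_] := FP _ FY; apply; [exact: XY|].
  by have [_] := FP _ FX; apply; [|exact: YX].
have [domG|/existsNP[a /not_implyP[Aa aG]]] :=
    pselect (forall a, A a -> exists b, G (a, b)).
  left; apply: (@card_le_rel _ _ _ _ (fun x y => G (x, y))) => [x /domG[y Gxy]|].
    by exists y => //; case: (GAB _ Gxy).
  by move=> x x' y Gx Gx'; apply/(Ginj _ _ Gx Gx').
have [ranG|/existsNP[b /not_implyP[Bb bG]]] :=
    pselect (forall b, B b -> exists a, G (a, b)).
  right; apply: (@card_le_rel _ _ _ _ (fun y x => G (x, y))) => [y /ranG[x Gxy]|].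
    by exists x => //; case: (GAB _ Gxy).
  by move=> y y' x Gy Gy'; apply/(Ginj _ _ Gy Gy').
exfalso; apply: (Gmax (G `|` [set (a, b)])).
  split; first by left.
  by move=> /(_ (a, b) (or_intror erefl)) Gab; apply: aG; exists b.
split=> [u [/GAB//|->//]|u v [Gu|->] [Gv|->]//=]; first exact: Ginj.
  split=> E; [case: aG; exists u.2|case: bG; exists u.1];
    by rewrite -E -surjective_pairing.
split=> E; [case: aG; exists v.2|case: bG; exists v.1];
  by rewrite E -surjective_pairing.
Qed.

(** Zorn's lemma gives a maximal family [F] of injective sequences with
    disjoint ranges. What they miss is finite, so every point has an address in
    [F * (nat * nat)]. A further natural number can be stored along with the
    address, because the resulting three numbers can be coded by a single
    position in the same sequence of [F]. *)
Lemma infinite_mul_nat T :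
  infinite_set [set: T] -> [set: T * nat] #<= [set: T].
Proof.
move=> Tinf.
pose P (F : set (nat -> T)) :=
  forall f g m n, F f -> F g -> f m = g n -> f = g /\ m = n.
have [C CP Ctot|F [FP Fmax]] := @Zorn_bigcup _ P.
  move=> f g m n [X CX Xf] [Y CY Yg].
  have [XY|YX] := Ctot _ _ CX CY; first by apply: (CP _ CY); [exact: XY|].
  by apply: (CP _ CX); [|exact: YX].
pose R := [set x | forall f n, F f -> f n <> x].
have Rfin : finite_set R.
  apply: contrapT => /infiniteP/card_leT_fun[g ginj Rg].
  apply: (Fmax (F `|` [set g])).
    split; first by left.
    by move=> /(_ g (or_intror erefl)) Fg; exact: (Rg 0 g 0).
  move=> f f' m n [Ff|->] [Ff'|->]; first exact: FP.
  - by move=> /(Rg n f m Ff).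
  - by move=> /esym/(Rg m f' n Ff').
  - by move/ginj.
have [f0 Ff0] : exists f, F f.
  apply: contrapT => /forallNP F0; apply: Tinf; apply: sub_finite_set Rfin.
  by move=> x _ f n /F0.
have /countable_injP[r rinj] := finite_set_countable Rfin.
(* [u] is an address of [x]: tag 0 for the position of [x] in a sequence of
   [F], any other tag for the rank of [x] among the finitely many missed
   points. *)
pose G x (u : (nat -> T) * (nat * nat)) :=
  F u.1 /\ if u.2.1 == 0 then u.1 u.2.2 = x else R x /\ u.2.2 = r x.
have G_inj x x' u : G x u -> G x' u -> x = x'.
  move=> [_ +] [_]; case: ifP => _; first by move=> ->.
  by move=> [Rx ->] [Rx' /rinj->]//; rewrite inE.
have G_tot x : exists u, G x u.
  have [Rx|/existsNP[f /existsNP[n /not_implyP[Ff /contrapT <-]]]] :=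
    pselect (R x); first by exists (f0, (1, r x)).
  by exists (f, (0, n)).
apply: (@card_le_rel _ _ _ _ (fun (u : T * nat) y =>
  exists v, G u.1 v /\ y = v.1 (pickle (v.2, u.2)))).
  move=> [x n] _ /=; have [v Gv] := G_tot x.
  by exists (v.1 (pickle (v.2, n))) => //; exists v.
move=> [x n] [x' n'] y /= [v [Gv ->]] [v' [Gv']] /FP[||E].
- by case: Gv.
- by case: Gv'.
move/(pcan_inj pickleK) => [E2 ->]; congr pair; apply: (G_inj _ _ v Gv).
by case: v v' E E2 Gv Gv' => [? ?] [? ?] /= -> ->.
Qed.

(** * Large sets *)

Section Large.
Variable T : Type.
Implicit Types (A B : set T) (f g : sym T).

Definition large A := [set: T] #<= A.

Lemma large_subset A B : A `<=` B -> large A -> large B.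
Proof. by move=> AB /card_le_trans; apply; exact: subset_card_le. Qed.

Lemma largeT : large setT. Proof. exact: card_lexx. Qed.

Lemma large_card_eq A : (A #= [set: T]) = large A.
Proof. by rewrite card_eq_le card_leT. Qed.

Lemma large_eq A B : large A -> large B -> A #= B.
Proof.
rewrite -!large_card_eq => /card_eq_trans AT BT.
by apply: AT; exact: card_esym.
Qed.

Lemma large_preimage f A : large (f @^-1` A) <-> large A.
Proof.
split=> /card_le_trans; apply.
  by apply: (@card_le_fun _ _ _ _ f) => // x y _ _ /(can_inj (sym_funK f)).
apply: (@card_le_fun _ _ _ _ (sym_inv f)) => [x Ax|x y _ _].
  by rewrite /= sym_invK.
exact: (can_inj (sym_invK f)).
Qed.

Hypothesis Tinf : infinite_set [set: T].

Lemma large_neq0 A : large A -> A !=set0.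
Proof.
move=> Al; apply/set0P/eqP => A0; apply: Tinf.
by move: Al; rewrite /large A0 card_le0 => /eqP->; exact: finite_set0.
Qed.

(** If [B] is the smaller of the two sets, then [A] is infinite and the union
    embeds into [A * nat], hence into [A]. *)
Lemma large_setU A B : large (A `|` B) -> large A \/ large B.
Proof.
wlog BA : A B / B #<= A => [IH|] AB.
  have [AB'|BA] := card_le_total A B; last exact: IH.
  by apply/or_comm; apply: IH => //; rewrite setUC.
left; apply: (card_le_trans AB).
have Ainf : infinite_set A.
  move=> Afin; apply: Tinf; apply: card_le_finite AB _.
  by rewrite finite_setU; split => //; exact: card_le_finite BA Afin.
have : infinite_set [set: set_type A].
  by rewrite (eq_finite_set (card_setT A)).
move=> /infinite_mul_nat; rewrite (card_le_eqr (card_setT A)).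
apply: card_le_trans; move/card_leP : BA => [h].
apply: (@card_le_rel _ _ _ _ (fun x (u : set_type A * nat) =>
   (x = val u.1 /\ u.2 = 0) \/
   exists y : set_type B, [/\ x = val y, u.1 = h y & u.2 = 1])) => [x ABx|].
  have [Ax|Ax] := pselect (A x).
    by exists (SigSub (mem_set Ax), 0) => //; left.
  have Bx : B x by case: ABx.
  by exists (h (SigSub (mem_set Bx)), 1) => //; right; exists (SigSub (mem_set Bx)).
move=> x x' [a k] /= [[-> ->]|[y [-> -> ->]]] [[-> //]|[y' [-> + //]]].
by move=> /(inj (mem_set I) (mem_set I)) ->.
Qed.

Lemma large_fiber (K : finType) (c : T -> K) A :
  large A -> exists k, large [set x | A x /\ c x = k].
Proof.
move=> Al.
suff H (s : seq K) : large [set x | A x /\ c x \in s] ->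
    exists k, large [set x | A x /\ c x = k].
  by apply: (H (enum K)); apply: large_subset Al => x Ax; rewrite /= mem_enum.
elim: s => [/large_neq0[x []]//|k s IH kl].
have /large_setU[] : large ([set x | A x /\ c x = k] `|`
    [set x | A x /\ c x \in s]).
- by apply: large_subset kl => x [Ax]; rewrite inE => /orP[/eqP|]; [left|right].
- by exists k.
- exact: IH.
Qed.

(** A large class embeds [T * nat], so it splits into countably many large
    sets; doing this in every large class of [p] separately yields one
    colouring for all of them. *)
Lemma split_large I (K : countType) (k0 : K) (p : T -> I) : exists c : T -> K,
  forall i k, large [set x | p x = i] -> large [set x | p x = i /\ c x = k].
Proof.
pose A i := [set x | p x = i].
have H i : exists c : T -> K,
    large (A i) -> forall k, large [set x | A i x /\ c x = k].
  have [Ai|] := pselect (large (A i)); last by exists (fun=> k0).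
  have /card_leT_fun[e einj eA] := card_le_trans (infinite_mul_nat Tinf) Ai.
  have /choice[d dP] x : exists m, forall z n, e (z, n) = x -> m = n.
    have [[u <-]|N] := pselect (exists u, e u = x).
      by exists u.2 => z n /einj <-.
    by exists 0 => z n ezn; case: N; exists (z, n).
  (* [d] reads off the [nat] component on the image of [e] *)
  exists (fun x => odflt k0 (unpickle (d x))) => _ k.
  apply: (@card_le_fun _ _ _ _ (fun z => e (z, pickle k))) => [z _|z z' _ _].
    by split; [exact: eA|rewrite (dP _ z (pickle k))// pickleK].
  by move=> /einj[].
have /choice[c cP] := H.
exists (fun x => c (p x) x) => i k /cP/(_ k).
by apply: large_subset => x [xi ck]; split; rewrite ?xi.
Qed.

(** Two colourings with equinumerous classes differ by a permutation, glued
    from bijections between corresponding classes. *)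
Lemma colour_bij K (c d : T -> K) :
    (forall k, [set x | c x = k] #= [set y | d y = k]) ->
  exists a : sym T, forall x, d (a x) = c x.
Proof.
move=> cd; pose C k := [set x | c x = k]; pose D k := [set y | d y = k].
have H k : exists u : (set_type (C k) -> D k) * (D k -> set_type (C k)),
    cancel u.1 u.2 /\ cancel u.2 u.1.
  by have /card_bijP[f [g fK gK]] := cd k; exists (f, g).
have /all_tag[u uK] := fun k => cid (H k).
pose a x := val ((u (c x)).1 (SigSub (mem_set (erefl : C (c x) x)))).
pose b y := val ((u (d y)).2 (SigSub (mem_set (erefl : D (d y) y)))).
have aE k (x : set_type (C k)) : a (val x) = val ((u k).1 x).
  case: x => x xk /=; have xk' : c x = k := set_mem xk; case: k / xk' in xk *.
  by rewrite /a (bool_irrelevance (mem_set _) xk).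
have bE k (y : set_type (D k)) : b (val y) = val ((u k).2 y).
  case: y => y yk /=; have yk' : d y = k := set_mem yk; case: k / yk' in yk *.
  by rewrite /b (bool_irrelevance (mem_set _) yk).
have aK : cancel a b by move=> x; rewrite /a bE (uK _).1.
have bK : cancel b a by move=> x; rewrite /b aE (uK _).2.
exists (Defs.Sym (Bijective aK bK)) => x /=.
exact: (set_mem (valP ((u (c x)).1 _))).
Qed.

Lemma colour_bij_large K (c d : T -> K) :
    (forall k, (large [set x | c x = k] /\ large [set y | d y = k]) \/
               ((forall x, c x <> k) /\ (forall y, d y <> k))) ->
  exists a : sym T, forall x, d (a x) = c x.
Proof.
move=> cd; apply: colour_bij => k; have [[ck dk]|[ck dk]] := cd k.
  exact: large_eq.
have -> : [set x | c x = k] = set0 by apply/seteqP; split => x // /ck.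
have -> : [set y | d y = k] = set0 by apply/seteqP; split => y // /dk.
exact: card_eqxx.
Qed.

(** Inside the classes of [r1] and [r2] the colourings [p] and [q] define
    pieces. Every large piece at the source splits into one large portion per
    target piece and a large remainder; do the same at the target, and match
    corresponding portions. In each class, everything left over is then
    matched in one go, which is possible because it contains the remainder of
    some large piece on either side. *)
Lemma generic_bij J (I K : finType) (r1 r2 : T -> J) (p : T -> I) (q : T -> K) :
    (forall j, large [set x | r1 x = j]) ->
    (forall j, large [set y | r2 y = j]) ->
  exists2 a : sym T, (forall x, r2 (a x) = r1 x) &
    forall j i k, large [set x | r1 x = j /\ p x = i] ->
      large [set y | r2 y = j /\ q y = k] ->
    large [set x | [/\ r1 x = j, p x = i & q (a x) = k]].
Proof.
move=> r1l r2l.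
have [c cP] := split_large (None : option K) (fun x => (r1 x, p x)).
have [d dP] := split_large (None : option I) (fun y => (r2 y, q y)).
(* [C] and [D] name the portion containing a point; [None] stands for the
   remainder of the whole class, and a portion is kept only when its two
   pieces are large, so that it has the same size on both sides. *)
pose both j i k := large [set x | r1 x = j /\ p x = i] /\
  large [set y | r2 y = j /\ q y = k].
pose C x := (r1 x, obind (fun k =>
  if `[< both (r1 x) (p x) k >] then Some (p x, k) else None) (c x)).
pose D y := (r2 y, obind (fun i =>
  if `[< both (r2 y) i (q y) >] then Some (i, q y) else None) (d y)).
have cE j i k : large [set x | r1 x = j /\ p x = i] ->
    large [set x | [/\ r1 x = j, p x = i & c x = k]].
  move=> H; have /(_ k) := cP (j, i).
  move/(_ (large_subset _ H)) => {}H.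
  by apply: large_subset (H _) => [x /= [[-> ->] ->]|x /= [-> ->]].
have dE j i k : large [set y | r2 y = j /\ q y = k] ->
    large [set y | [/\ r2 y = j, q y = k & d y = i]].
  move=> H; have /(_ i) := dP (j, k).
  move/(_ (large_subset _ H)) => {}H.
  by apply: large_subset (H _) => [x /= [[-> ->] ->]|x /= [-> ->]].
have CE j i k : both j i k ->
    [set x | [/\ r1 x = j, p x = i & c x = Some k]] `<=`
    [set x | C x = (j, Some (i, k))].
  by move=> b x [xj xi xk]; rewrite /= /C xj xi xk /= asboolT.
have [a aP] : exists a : sym T, forall x, D (a x) = C x.
  apply: colour_bij_large => -[j [[i k]|]].
    have [b|Nb] := pselect (both j i k).
      left; split; first by exact: large_subset (CE _ _ _ b) (cE _ _ _ b.1).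
      apply: large_subset (dE _ (Some i) _ b.2) => y [yj yk yi].
      by rewrite /= /D yj yk yi /= asboolT.
    right; split=> [x|y]; rewrite /C /D.
      by case: (c x) => [k'|//] /= [xj]; case: asboolP => // b [xi kk]; apply: Nb;
        rewrite -xj -xi -kk.
    by case: (d y) => [i'|//] /= [xj]; case: asboolP => // b [xi kk]; apply: Nb;
      rewrite -xj -xi -kk.
  left; split.
    have [i ji] := large_fiber p (r1l j).
    by apply: large_subset (cE _ _ None ji) => x [xj _ xN]; rewrite /= /C xN xj.
  have [k jk] := large_fiber q (r2l j).
  by apply: large_subset (dE _ None _ jk) => x [xj _ xN]; rewrite /= /D xN xj.
exists a => [x|j i k ji jk]; first by have [] := aP x.
apply: large_subset (cE _ _ (Some k) ji) => x xijk.
have /(_ x xijk) /= := CE j i k (conj ji jk).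
case: xijk => xj xi xk; rewrite -aP /D => -[_].
case: (d (a x)) => [i'|//] /=; case: ifP => // _ [_ ak].
by split.
Qed.

End Large.

(** * Maximisation and permutations of indices *)

Lemma bounded_argmax X (P : set X) (mu : X -> nat) N :
    (forall x, P x -> mu x <= N) -> P !=set0 ->
  exists2 x, P x & forall y, P y -> mu y <= mu x.
Proof.
move=> muN [x0 Px0].
have ex : exists k, `[< exists2 x, P x & mu x = k >].
  by exists (mu x0); apply/asboolP; exists x0.
have ub k : `[< exists2 x, P x & mu x = k >] -> k <= N.
  by move=> /asboolP[x /muN + <-].
case: (ex_maxnP ex ub) => k /asboolP[x Px <-] kmax.
by exists x => // y Py; apply: kmax; apply/asboolP; exists y.
Qed.

Lemma perm_move2 (I : finType) (j1 j2 i1 i2 : I) : j1 != j2 -> i1 != i2 ->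
  exists s : {perm I}, s j1 = i1 /\ s j2 = i2.
Proof.
move=> j12 i12; exists (tperm j1 i1 * tperm (tperm j1 i1 j2) i2)%g.
rewrite !permM !tpermL; split => //; rewrite tpermD// 1?eq_sym//.
by rewrite -[X in X != _](tpermL j1 i1) (inj_eq perm_inj).
Qed.

(** * Links between parts *)

(** Disjointness makes [X #+ Y] equipotent to the union of [X] and [Y], so that
    [large_setU] applies to it. *)
Lemma card_sum_lt T (X Y : set T) : infinite_set [set: T] ->
  X `&` Y = set0 -> ((X #+ Y) #< [set: T]) = ~~ large X && ~~ large Y.
Proof.
move=> Tinf XY; rewrite -negb_or.
have sumU : X #+ Y #<= X `|` Y.
  apply: (@card_le_fun _ _ _ _ (fun u : set_type X + set_type Y =>
      match u with inl x => val x | inr y => val y end)) => [[x|y] _|].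
  - by left; exact: set_mem (valP x).
  - by right; exact: set_mem (valP y).
  have XYF (x : set_type X) (y : set_type Y) : val x <> val y.
    move=> xy; suff : (X `&` Y) (val x) by rewrite XY.
    by split; [exact: set_mem (valP x)|rewrite xy; exact: set_mem (valP y)].
  by move=> [x|y] [x'|y'] _ _ => [/val_inj->|/XYF|/esym/XYF|/val_inj->].
have lX : X #<= X #+ Y.
  rewrite -(card_le_eql (card_setT X)).
  by apply: (@card_le_fun _ _ _ _ inl) => // x y _ _ [].
have lY : Y #<= X #+ Y.
  rewrite -(card_le_eql (card_setT Y)).
  by apply: (@card_le_fun _ _ _ _ inr) => // x y _ _ [].
rewrite /card_lt card_eq_le (card_le_trans sumU (card_leT _)) /=; congr (~~ _).
apply/idP/orP => [TXY|[XT|YT]].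
- by apply: large_setU => //; exact: card_le_trans TXY sumU.
- exact: card_le_trans XT lX.
- exact: card_le_trans YT lY.
Qed.

Section Links.
Variables (T : Type) (n : nat) (p : T -> 'I_n).
Hypothesis Tinf : infinite_set [set: T].
Hypothesis p_large : forall i, large [set x | p x = i].
Implicit Types (f g h a : sym T) (i j k : 'I_n).

Definition link f i j := large [set x | p x = i /\ p (f x) = j].

Lemma link_row f i : exists j, link f i j.
Proof.
have [j ij] := large_fiber Tinf (p \o f) (p_large i).
by exists j; apply: large_subset ij => x [].
Qed.

Lemma link_col f j : exists i, link f i j.
Proof.
have [i ij] := large_fiber Tinf p ((large_preimage f _).2 (p_large j)).
by exists i; apply: large_subset ij => x [].
Qed.

Lemma link_mul f g i k : link (f * g)%g i k -> exists j, link f i j && link g j k.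
Proof.
move=> /(large_fiber Tinf (p \o f))[j ijk]; exists j; apply/andP; split.
  by apply: large_subset ijk => x [[]].
by apply/(large_preimage f); apply: large_subset ijk => x [[]].
Qed.

Lemma link_perm a (s : 'I_n -> 'I_n) i j :
  (forall x, p (a x) = s (p x)) -> link a i j -> j = s i.
Proof. by move=> as_ /(large_neq0 Tinf)[x [<- <-]]. Qed.

(** The links of [f * g] need not contain the composition of the link
    relations, since the image of [f] in a part can miss what [g] sends
    elsewhere; a generic permutation in between repairs this. *)
Lemma link_compose f g (s : {perm 'I_n}) : exists2 a : sym T,
  (forall x, p (a x) = s (p x)) &
  forall i j k, link f i j -> link g (s j) k -> link (f * (a * g))%g i k.
Proof.
have sl j : large [set x | s (p x) = j].
  by apply: large_subset (p_large (s^-1%g j)) => x /= ->; rewrite permKV.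
have [a ap aP] :=
  generic_bij Tinf (fun x => p (sym_inv f x)) (p \o g) sl p_large.
exists a => // i j k fij gjk.
have /aP/(_ gjk) : large [set x | s (p x) = s j /\ p (sym_inv f x) = i].
  apply/(large_preimage f); apply: large_subset fij => x [xi xj].
  by rewrite /= sym_funK xi xj.
move=> /(large_preimage f _).2; apply: large_subset => x [_ + <-] /=.
by rewrite sym_funK.
Qed.

Definition functional_links : set (sym T) :=
  [set f | forall i j j', link f i j -> link f i j' -> j = j'].

Lemma functional_links_mul f g :
  functional_links f -> functional_links g -> functional_links (f * g)%g.
Proof.
move=> fP gP i k k' /link_mul[j /andP[fj gk]] /link_mul[j' /andP[fj' gk']].
by move: gk'; rewrite -(fP _ _ _ fj fj'); exact: gP.
Qed.

Lemma functional_links_perm a (s : 'I_n -> 'I_n) :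
  (forall x, p (a x) = s (p x)) -> functional_links a.
Proof. by move=> ap i j j' /(link_perm ap)-> /(link_perm ap)->. Qed.

(** A single-valued link relation is a surjective map between finite sets of
    the same size, hence a bijection [r] with inverse [c]. Thus the image of
    part [i] almost lies in part [r i], and almost nothing of part [r i] comes
    from another part. *)
Lemma AStabE : AStab (fun i => [set x | p x = i]) = functional_links.
Proof.
apply/seteqP; split => f fP.
  move=> i; have [j] := fP i.
  rewrite card_sum_lt//; last by apply/seteqP; split=> [x [[_ ?] []]|].
  move=> /andP[Xs _]; suff H j' : link f i j' -> j' = j by move=> j1 j2 /H-> /H->.
  move=> ij'; apply: contraNeq Xs => jj'; apply/(large_preimage f).
  apply: large_subset ij' => x [xi xj']; split; first by exists x.
  by rewrite /= xj' => /eqP; exact/negP.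
have /choice[r rP] := link_row f.
have /choice[c cP] := link_col f.
have rK : cancel r c.
  by apply: canF_sym => j; apply: fP (cP j); exact: rP.
move=> i; exists (r i); rewrite card_sum_lt//; last first.
  by apply/seteqP; split=> [x [[_ ?] []]|].
apply/andP; split; apply/negP => /(large_preimage f _).2.
  move=> /(large_fiber Tinf (p \o f))[j' H].
  have /(large_neq0 Tinf)[x [[_ xr] xj']] := H.
  apply: xr => /=; rewrite -[p _]/((p \o f) x) xj'; apply: fP (rP i).
  apply: large_subset H => y [[[z zi /(can_inj (sym_funK f)) zy] _] yj'].
  by split=> //; rewrite -zy.
move=> /(large_fiber Tinf p)[i' H].
have /(large_neq0 Tinf)[x [[_ xi] xi']] := H.
apply: xi; exists x => //=; rewrite xi'; apply: (can_inj rK).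
apply: (fP i') => //.
by apply: large_subset H => y [[]].
Qed.

Definition all_linked f := forall i j, link f i j.

(** A permutation [f] that is generic with respect to both the partition and
    its inverse image under [h] spreads every part and every inverse image
    over all parts. *)
Lemma all_linked_factor h : exists f, all_linked f /\ all_linked (f^-1 * h)%g.
Proof.
have [a _ aP] := generic_bij Tinf (fun x => (p x, p (h x))) p
  (r1 := fun=> tt) (r2 := fun=> tt)
  (fun 'tt => large_subset (fun _ _ => erefl) (largeT T))
  (fun 'tt => large_subset (fun _ _ => erefl) (largeT T)).
have {}aP i j k : link h i j ->
    large [set x | [/\ p x = i, p (h x) = j & p (a x) = k]].
  move=> hij.
  have : large [set x | [/\ tt = tt, (p x, p (h x)) = (i, j) & p (a x) = k]].
    apply: aP; first by apply: large_subset hij => x [xi xj]; rewrite /= xi xj.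
    by apply: large_subset (p_large k).
  by apply: large_subset => x [_ [xi xj] xk].
exists a; split=> [i k|k j].
  have [j hij] := link_row h i.
  by apply: large_subset (aP _ _ k hij) => x [].
have [i hij] := link_col h j.
apply/(large_preimage a); apply: large_subset (aP _ _ k hij) => x [_ xj xk].
by split => //=; rewrite sym_funK.
Qed.

(** The sets of points going from part [i] to part [j] are large for both
    permutations, so some [a] preserving the parts carries those of [h] onto
    those of [f]; then the remaining factor preserves the parts as well. *)
Lemma all_linked_double_coset f h : all_linked f -> all_linked h ->
  exists a b, [/\ functional_links a, functional_links b & h = (a * (f * b))%g].
Proof.
move=> fl hl.
have [[i j]|a aP] := @colour_bij_large _ _
    (fun x => (p x, p (h x))) (fun y => (p y, p (f y))).
  by left; split; [apply: large_subset (hl i j)|apply: large_subset (fl i j)];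
    move=> x [/= -> ->].
exists a, (f^-1 * (a^-1 * h))%g; split; last by rewrite !mulKVg.
  by apply: (@functional_links_perm _ id) => x; have [] := aP x.
apply: (@functional_links_perm _ id) => y /=.
by have [_] := aP (sym_inv a (sym_inv f y)); rewrite !sym_invK.
Qed.

(** * Semigroups above the almost stabiliser *)

Variable U : set (sym T).
Hypothesis U_mul : forall f g, U f -> U g -> U (f * g)%g.
Hypothesis U_functional : functional_links `<=` U.

Lemma grow_link f g (s : {perm 'I_n}) : U f -> U g ->
  exists2 h, U h & forall i j k, link f i j -> link g (s j) k -> link h i k.
Proof.
move=> Uf Ug; have [a ap aP] := link_compose f g s.
exists (f * (a * g))%g => //; apply: U_mul => //; apply: U_mul => //.
by apply: U_functional; exact: functional_links_perm ap.
Qed.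

(** Choose [g] with as many links of [i] as possible, those to [j1] and [j2]
    included. If [c] is missed, it is linked to some [i'], and [g] composed with
    itself, moving [j1] to [i] and [j2] to [i'] in between, links [i] to [c] as
    well. *)
Lemma exists_full_row f i j1 j2 : U f -> j1 != j2 ->
  link f i j1 -> link f i j2 -> exists2 g, U g & forall j, link g i j.
Proof.
move=> Uf j12 f1 f2.
have [||g [Ug g1 g2] gmax] := @bounded_argmax _
    [set g | [/\ U g, link g i j1 & link g i j2]] (fun g => #|link g i|) n.
- by move=> g _; rewrite -[leqRHS]card_ord max_card.
- by exists f.
exists g => // c; apply: contrapT => /negP gc.
have [i' gi'c] := link_col g c.
have ii' : i != i' by apply: contraNneq gc => ->.
have [s [s1 s2]] := perm_move2 j12 ii'.
have [h Uh hP] := grow_link s Ug Ug.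
have gh j : link g i j -> link h i j by move=> gj; apply: hP g1 _; rewrite s1.
have := gmax h (And3 Uh (gh _ g1) (gh _ g2)); apply/negP; rewrite -ltnNge.
apply: proper_card; apply/fintype.properP; split.
  by apply/fintype.subsetP => j; exact: gh.
by exists c; rewrite ?unfold_in//; apply: hP g2 _; rewrite s2.
Qed.

(** Once part [i] has all links, a part linked to [j] acquires all of them when
    [j] is moved to [i] between two copies of [g]. Parts that already have all
    links are linked to [j], so their number increases strictly. *)
Lemma exists_all_linked f i j1 j2 : U f -> j1 != j2 ->
  link f i j1 -> link f i j2 -> exists2 g, U g & all_linked g.
Proof.
move=> Uf j12 f1 f2; have [g0 Ug0 g0i] := exists_full_row Uf j12 f1 f2.
pose full g := [pred i' | [forall j, link g i' j]].
have [||g [Ug gi] gmax] := @bounded_argmax _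
    [set g | U g /\ forall j, link g i j] (fun g => #|full g|) n.
- by move=> g _; rewrite -[leqRHS]card_ord max_card.
- by exists g0.
exists g => // i'; apply/forallP; apply: contrapT => /negP gi'.
have [j gi'j] := link_row g i'.
have [h Uh hP] := grow_link (tperm j i) Ug Ug.
have hfull i2 : link g i2 j -> forall k, link h i2 k.
  by move=> gj k; apply: hP gj _; rewrite tpermL.
have := gmax h (conj Uh (hfull _ (gi j))); apply/negP; rewrite -ltnNge.
apply: proper_card; apply/fintype.properP; split.
  by apply/fintype.subsetP => i2 /forallP gi2; apply/forallP; exact: hfull.
by exists i'; rewrite ?inE//; apply/forallP; exact: hfull.
Qed.

Lemma over_functional_links_setT f : U f -> ~ functional_links f -> U = setT.
Proof.
move=> Uf /existsNP[i /existsNP[j1 /existsNP[j2]]].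
move=> /not_implyP[f1 /not_implyP[f2 /eqP j12]].
have [g Ug gl] := exists_all_linked Uf j12 f1 f2.
have Ul h : all_linked h -> U h.
  move=> /(all_linked_double_coset gl)[a [b [aP bP ->]]].
  have [Ua Ub] := (U_functional aP, U_functional bP).
  by do 2?apply: U_mul.
apply/seteqP; split => // h _; have [k [kl khl]] := all_linked_factor h.
by rewrite -(mulKVg k h); apply: U_mul; exact: Ul.
Qed.

End Links.

Theorem theorem10p5 (T : Type) (n : nat) (Sigma : 'I_n -> set T) :
  infinite_set [set: T] ->
  finite_partition Sigma ->
  maximal_subsemigroup (AStab Sigma).
Proof.
move=> Tinf [n2 [cov triv _] Slarge].
have /choice[p pS] x : exists i, Sigma i x.
  have : cover setT Sigma x by rewrite cov.
  by case=> i _ Six; exists i.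
have SE : Sigma = fun i => [set x | p x = i].
  apply/funext => i; apply/seteqP; split=> [x Six|x <-//].
  by apply: triv => //; exists x.
have pl i : large [set x | p x = i].
  by rewrite -large_card_eq -[X in X #= _]/((fun i => [set x | p x = i]) i) -SE.
rewrite {}SE AStabE//.
have AM : subsemigroup (functional_links p).
  split; last exact: functional_links_mul.
  by exists 1%g; apply: (@functional_links_perm _ _ _ Tinf _ id).
split=> // [AT|f fN].
  have [h [hl _]] := all_linked_factor Tinf pl 1%g.
  have : functional_links p h by rewrite AT.
  (* the indices 0 and 1 are distinct, yet part 0 is linked to both *)
  move=> /(_ (Ordinal (ltnW n2)) (Ordinal (ltnW n2)) (Ordinal n2)).
  by move=> /(_ (hl _ _) (hl _ _))/(congr1 (@nat_of_ord n)) /=.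
apply: (over_functional_links_setT Tinf pl _ _ _ fN).
- move=> x y Ux Uy V HV; have [[_ VM] _] := HV.
  by apply: VM; [exact: Ux|exact: Uy].
- by move=> x Ax V [_ AV]; apply: AV; left.
- by move=> V [_ AV]; apply: AV; right.
Qed.
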